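(* Let $p\ge5$ be a prime with Legendre symbol $\left(\frac{-6}{p}\right)=-1$, and let $\alpha\ge0$, $n\ge0$ be integers. Then for every integer $i$ with $1\le i\le p-1$, $$\overline{S}_3\big(48p^{2\alpha+2}n+2(24i+5p)p^{2\alpha+1}\big)\equiv0\pmod{24}.$$
   Context: For $|q|<1$ and a positive integer $k$, write $f_k=\prod_{j\ge1}(1-q^{kj})$. The function $\overline{S}_3(n)$ (number of $3$-Schur overpartitions of $n$) is defined by $\sum_{n\ge0}\overline{S}_3(n)q^n=\prod_{n\ge1}\frac{(1+q^{2n-1})(1-q^{3(2n-1)})}{(1+q^{3(2n-1)})(1-q^{2n-1})}=\frac{f_2^3f_3^2f_{12}}{f_1^2f_4f_6^3}$. *)

(* Defs.v *)
From mathcomp Require Import all_boot all_order all_algebra.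

Set Implicit Arguments.
Unset Strict Implicit.
Unset Printing Implicit Defensive.

Import Order.TTheory GRing.Theory Num.Theory.
Local Open Scope ring_scope.

(* Formal power series in q over the integers: f n is the coefficient of q^n. *)
Definition fps := nat -> int.

Definition fps_one : fps := fun n => (n == 0%N)%:R.

(* 1 + c q^m *)
Definition fps_binom (c : int) (m : nat) : fps :=
  fun n => (n == 0%N)%:R + c *+ (n == m).

Definition fps_mul (f g : fps) : fps :=
  fun n => \sum_(i < n.+1) f i * g (n - i)%N.

(* The first n coefficients of 1/f, for f with constant term 1. *)
Fixpoint fps_inv_seq (f : fps) (n : nat) : seq int :=
  if n is m.+1 then
    let s := fps_inv_seq f m in
    rcons s ((m == 0%N)%:R - \sum_(i < m) s`_i * f (m - i)%N)
  else [::].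

(* Only meaningful when f 0 = 1; see fps_mulVf. *)
Definition fps_inv (f : fps) : fps := fun n => (fps_inv_seq f n.+1)`_n.

Definition fps_div (f g : fps) : fps := fps_mul f (fps_inv g).

(* F 1 * F 2 * ... * F N *)
Fixpoint fps_prod (F : nat -> fps) (N : nat) : fps :=
  if N is M.+1 then fps_mul (fps_prod F M) (F M.+1) else fps_one.

(* The infinite product F 1 * F 2 * ...  It is only meaningful when            *)
(* F j = 1 + O(q^j) for all j >= 1: the coefficient of q^n in the partial      *)
(* products is then constant from the n-th one on; see fps_infprod_stable.     *)
Definition fps_infprod (F : nat -> fps) : fps := fun n => fps_prod F n n.

Definition schur3_factor (j : nat) : fps :=
  let m := (2 * j - 1)%N in
  fps_div (fps_mul (fps_binom 1 m) (fps_binom (-1) (3 * m)))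
          (fps_mul (fps_binom 1 (3 * m)) (fps_binom (-1) m)).

(* The number of 3-Schur overpartitions of n. *)
Definition S3bar (n : nat) : int := fps_infprod schur3_factor n.

(* The Legendre symbol (a/p), for p an odd prime. *)
Definition legendre (a : int) (p : nat) : int :=
  if (p %| a)%Z then 0
  else if [exists x : 'I_p, ((x : nat)%:Z ^+ 2 == a %[mod p])%Z] then 1 else -1.

Lemma size_fps_inv_seq f n : size (fps_inv_seq f n) = n.
Proof. by elim: n => //= n IHn; rewrite size_rcons IHn. Qed.

Lemma nth_fps_inv_seq f n i : (i < n)%N -> (fps_inv_seq f n)`_i = fps_inv f i.
Proof.
elim: n => // n IHn; rewrite ltnS leq_eqVlt => /predU1P[-> // | lt_in].
by rewrite /= nth_rcons size_fps_inv_seq lt_in IHn.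
Qed.

Lemma fps_mulVf f : f 0%N = 1 -> fps_mul (fps_inv f) f =1 fps_one.
Proof.
move=> f0 n; rewrite /fps_mul big_ord_recr /= subnn f0 mulr1.
rewrite {2}/fps_inv /= nth_rcons size_fps_inv_seq ltnn eqxx.
under [X in _ - X]eq_bigr => i _ do rewrite nth_fps_inv_seq //.
by rewrite addrC subrK.
Qed.

(* f = 1 + O(q^j) *)
Definition fps_one_mod (j : nat) (f : fps) : Prop :=
  forall i, (i < j)%N -> f i = fps_one i.

Lemma fps_mul1_mod j f g :
  fps_one_mod j g -> forall i, (i < j)%N -> fps_mul f g i = f i.
Proof.
move=> g1 i lt_ij; rewrite /fps_mul big_ord_recr /= subnn g1 ?(leq_ltn_trans _ lt_ij) //.
rewrite mulr1 big1 ?add0r // => k _.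
rewrite g1 ?(leq_ltn_trans (leq_subr _ _)) //.
by rewrite /fps_one subn_eq0 leqNgt ltn_ord mulr0.
Qed.

Lemma fps_mul_one_mod j f g :
  fps_one_mod j f -> fps_one_mod j g -> fps_one_mod j (fps_mul f g).
Proof. by move=> f1 g1 i lt_ij; rewrite (fps_mul1_mod f g1) ?f1. Qed.

Lemma fps_inv_one_mod j f : fps_one_mod j f -> fps_one_mod j (fps_inv f).
Proof.
move=> f1 i lt_ij; have f0 : f 0%N = 1 by rewrite f1 // (leq_ltn_trans _ lt_ij).
by rewrite -(fps_mul1_mod (fps_inv f) f1 lt_ij) fps_mulVf.
Qed.

Lemma fps_binom_one_mod c m j : (j <= m)%N -> fps_one_mod j (fps_binom c m).
Proof.
move=> le_jm i lt_ij; rewrite /fps_binom /fps_one.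
by rewrite (ltn_eqF (leq_trans lt_ij le_jm)) addr0.
Qed.

Lemma fps_infprod_stable F n N :
  (forall j, (0 < j)%N -> fps_one_mod j (F j)) ->
  (n <= N)%N -> fps_prod F N n = fps_infprod F n.
Proof.
move=> F1; elim: N => [|N IHN]; first by rewrite leqn0 => /eqP->.
rewrite leq_eqVlt => /predU1P[-> // | lt_nN].
by rewrite /= (fps_mul1_mod _ (F1 N.+1 isT)) // IHN.
Qed.

Lemma schur3_factor_one_mod j :
  (0 < j)%N -> fps_one_mod j (schur3_factor j).
Proof.
move=> j_gt0; have le_jm : (j <= 2 * j - 1)%N.
  by rewrite mul2n -addnn -addnBA // leq_addr.
have le_j3m : (j <= 3 * (2 * j - 1))%N by rewrite (leq_trans le_jm) // leq_pmull.
by apply: fps_mul_one_mod; last apply: fps_inv_one_mod;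
   apply: fps_mul_one_mod; apply: fps_binom_one_mod.
Qed.

Lemma S3bar_prod n N : (n <= N)%N -> S3bar n = fps_prod schur3_factor N n.
Proof. by move/(fps_infprod_stable schur3_factor_one_mod). Qed.

(* Main.v *)
Require Import Defs.
From mathcomp Require Import all_boot all_order all_algebra.
From mathcomp Require Import zify ring.

(* Put phi(q) = sum_x (-1)^x q^(x^2).  Gauss's product phi(q) = prod_j (1 - q^j)/(1 + q^j)   *)
(* turns the generating function into G = phi(q^2) phi(q^3) / (phi(q) phi(q^6)), so only    *)
(* theta series matter.  The argument N is 10 modulo 48 and has odd p-adic valuation.       *)
(* Modulo 8, phi^4 = 1, hence G = phi(q^2) phi(q^3) phi(q)^3 phi(q^6)^3; expanding, the     *)
(* congruence N = 10 mod 48 kills every term but those from representations                 *)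
(* N = x^2 + 6 y^2, and these do not exist because p is inert in Q(sqrt(-6)).               *)
(* Modulo 3, phi(q)^3 = phi(q^3), hence G phi(q^6) = phi(q)^2 phi(q^2).  Multiplying by     *)
(* psi = sum_w q^(6 w^2) makes the left factor a series in q^12, so it suffices that the    *)
(* coefficients of phi(q)^2 phi(q^2) psi at exponents 10 mod 12 vanish modulo 3; these are  *)
(* signed counts of u^2 + v^2 + z^2 + 3 w^2 = n with n = 5 mod 6, which cancel in threes    *)
(* under the rotation of order 3 of the form v^2 + 3 w^2.                                   *)

Set Implicit Arguments.
Unset Strict Implicit.
Unset Printing Implicit Defensive.

Import Order.TTheory GRing.Theory Num.Theory.
Local Open Scope ring_scope.

(** Gauss's product, taken at q and at q^3, turns the generating function G into a quotient of four
    theta series ([gauss_nilp], [theta_quotient], [S3bar_theta_quotient]). All identities live in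
    Z[q]/(q^(K+1)), where q is nilpotent: no limits occur, and every series with constant term 1 can
    be cancelled. The argument is N = p^(2 alpha + 1) M with p not dividing M, and N = 10 mod 48.

    Divisibility by 8 ([mod8_expansion], [S3bar_dvd8]): with phi = 1 + 2t, expanding G modulo 8
    leaves single t's and products of two. Their coefficients at N come from representations of N by
    small binary forms. Congruences modulo 48 exclude these forms, apart from x^2 + y^2, handled by
    a parity argument, and x^2 + 6 y^2, which cannot represent a number of odd p-adic valuation
    since -6 is a nonresidue ([odd_valuation_not_norm]).

    Divisibility by 3 ([S3bar_mod3], [theta4_dvd3], [S3bar_dvd3]): phi(q)^3 = phi(q^3) modulo 3
    reduces the claim to signed counts for a quaternary form, which vanish modulo 3 by a rotation of
    order 3. *)

(** * Theta series at a nilpotent argument and Gauss's product *)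

Definition box (B : nat) : seq int :=
  [seq Posz i | i <- iota 0 B.+1] ++ [seq Negz i | i <- iota 0 B].

Lemma mem_box B (x : int) : (x \in box B) = (`|x| <= B)%N.
Proof.
rewrite mem_cat; case: x => m.
  rewrite mem_map ?mem_iota ?orbF; last by move=> ? ? [].
  have -> : (m%:Z \in [seq Negz i | i <- iota 0 B]) = false.
    by apply/negbTE/mapP => -[].
  by rewrite orbF add0n ltnS.
have -> : (Negz m \in [seq Posz i | i <- iota 0 B.+1]) = false.
  by apply/negbTE/mapP => -[].
by rewrite mem_map ?mem_iota //; move=> ? ? [].
Qed.

Lemma box_uniq B : uniq (box B).
Proof.
rewrite cat_uniq !map_inj_uniq ?iota_uniq; try by move=> ? ? [].
by rewrite andbT; apply/hasPn => _ /mapP[i _ ->]; apply/mapP => -[].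
Qed.

Lemma sum_box (V : nmodType) B (F : nat -> V) :
  \sum_(i <- box B) F `|i|%N = F 0%N + (\sum_(1 <= s < B.+1) F s) *+ 2.
Proof.
rewrite big_cat !big_map /= big_cons -addrA mulr2n; congr (_ + (_ + _)).
  by rewrite /index_iota subn1.
by rewrite big_add1 /index_iota subn0.
Qed.

(* With x ^+ B.+1 = 0 this is the full series phi(x) of the header for c = -1, and
   sum_i x^(i^2) for c = 1. *)
Definition theta (A : pzSemiRingType) (B : nat) (c x : A) : A :=
  \sum_(i <- box B) c ^+ `|i|%N * x ^+ (`|i| ^ 2)%N.

Lemma thetaE (A : pzSemiRingType) B (c x : A) :
  theta B c x = 1 + (\sum_(1 <= s < B.+1) c ^+ s * x ^+ (s ^ 2)) *+ 2.
Proof.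
by rewrite /theta (sum_box _ (fun s => c ^+ s * x ^+ (s ^ 2))) !expr0 mulr1.
Qed.

Lemma thetaS (A : pzSemiRingType) B (c x : A) :
  theta B.+1 c x = theta B c x + c ^+ B.+1 * x ^+ (B.+1 ^ 2) *+ 2.
Proof. by rewrite !thetaE big_nat_recr //= mulrnDl addrA. Qed.

Lemma expr_nilp (A : pzSemiRingType) (x : A) n m :
  x ^+ n = 0 -> (n <= m)%N -> x ^+ m = 0.
Proof. by move=> x0 /subnK<-; rewrite exprD x0 mulr0. Qed.

Lemma theta_stable (A : pzSemiRingType) n m (c x : A) :
  x ^+ n.+1 = 0 -> (n <= m)%N -> theta m c x = theta n c x.
Proof.
move=> x0; elim: m => [|m IHm]; first by rewrite leqn0 => /eqP->.
rewrite leq_eqVlt => /predU1P[<- //|le_nm]; rewrite thetaS IHm //.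
by rewrite (expr_nilp x0) ?mulr0 ?mul0rn ?addr0 //; nia.
Qed.

(* Passing from n to n + 1, the summands on the right change by a telescoping difference,
   and all but the first of them vanish once x^(n+1) = 0. *)
Lemma gauss_finite (A : comNzRingType) n (x : A) :
  theta n (-1) x * \prod_(1 <= j < n.+1) (1 + x ^+ j) =
  \sum_(0 <= s < n.+1) (-1) ^+ s * x ^+ (s * n.+1) *
    \prod_(s.+1 <= j < n.+1) (1 - x ^+ j) * \prod_(0 <= j < s) (1 + x ^+ j).
Proof.
elim: n => [|n IHn].
  by rewrite thetaE big_nat1 !big_geq // mul0n !expr0 mul0rn addr0 !mulr1.
pose R s : A := \prod_(0 <= j < s) (1 + x ^+ j).
pose P s n : A := \prod_(s <= j < n) (1 - x ^+ j).
pose T s : A := (-1) ^+ s * x ^+ (s * n.+1) * P s.+1 n.+1 * R s.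
pose U s : A := (-1) ^+ s * x ^+ (s * n.+1) * P s n.+1 * R s.
have RS s : R s.+1 = R s * (1 + x ^+ s) by rewrite /R big_nat_recr.
(* The factor j = 0 of [R] is 1 + x^0 = 2; it absorbs the 2 in front of the new term of theta. *)
have Q2 : R n.+2 = (\prod_(1 <= j < n.+2) (1 + x ^+ j)) *+ 2.
  by rewrite /R big_ltn // expr0 -[1 + 1]/(2%:R) mulr_natl.
have TU s : (s < n.+1)%N ->
    T s * (1 + x ^+ n.+1) = (-1) ^+ s * x ^+ (s * n.+2) * P s.+1 n.+2 * R s
      + (U s - U s.+1).
  move=> lt_sn; rewrite /T /U RS.
  have -> : P s.+1 n.+2 = P s.+1 n.+1 * (1 - x ^+ n.+1).
    by rewrite /P big_nat_recr.
  have -> : P s n.+1 = (1 - x ^+ s) * P s.+1 n.+1 by rewrite /P big_ltn.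
  have -> : x ^+ (s * n.+2) = x ^+ (s * n.+1) * x ^+ s.
    by rewrite -exprD; congr (_ ^+ _); lia.
  have -> : x ^+ (s.+1 * n.+1) = x ^+ (s * n.+1) * x ^+ n.+1.
    by rewrite -exprD; congr (_ ^+ _); lia.
  by rewrite (exprS (-1)); ring.
have -> : theta n.+1 (-1) x * \prod_(1 <= j < n.+2) (1 + x ^+ j) =
   (theta n (-1) x * \prod_(1 <= j < n.+1) (1 + x ^+ j)) * (1 + x ^+ n.+1)
   + (-1) ^+ n.+1 * x ^+ (n.+1 ^ 2) * R n.+2.
  rewrite thetaS Q2 [in RHS]mulrnAr -[in RHS]mulrnAl mulrDl.
  by congr (_ + _); rewrite big_nat_recr //= mulrA.
rewrite IHn mulr_suml.
rewrite (eq_big_nat _ _ (F2 := fun s => (-1) ^+ s * x ^+ (s * n.+2) *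
   P s.+1 n.+2 * R s + (U s - U s.+1))); last first.
  by move=> s /andP[_ lt_sn]; rewrite -TU.
rewrite big_split /= [in RHS]big_nat_recr //= -addrA; congr (_ + _).
rewrite (telescope_sumr_eq (fun s => - U s)) //; last first.
  by move=> s _; rewrite opprK addrC.
rewrite {1}/U /P big_geq // (RS n.+1).
have -> : U 0%N = 0 by rewrite /U /P big_ltn // expr0 subrr !(mul0r, mulr0).
rewrite big_geq //.
have -> : x ^+ (n.+1 * n.+2) = x ^+ (n.+1 ^ 2) * x ^+ n.+1.
  by rewrite -exprD; congr (_ ^+ _); lia.
by rewrite -/(R n.+1); move: (R n.+1) (x ^+ (n.+1 ^ 2)) => r y; ring.
Qed.

Lemma gauss_nilp (A : comNzRingType) n (x : A) : x ^+ n.+1 = 0 ->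
  theta n (-1) x * \prod_(1 <= j < n.+1) (1 + x ^+ j) =
  \prod_(1 <= j < n.+1) (1 - x ^+ j).
Proof.
move=> x0; rewrite gauss_finite [\sum_(0 <= s < _) _]big_ltn // mul0n !expr0 !mul1r.
rewrite [\prod_(0 <= j < 0) _]big_geq // mulr1.
rewrite [X in _ + X]big_nat_cond [X in _ + X]big1 ?addr0 //.
move=> s /andP[/andP[s_gt0 _] _].
by rewrite (expr_nilp x0) ?mulr0 ?mul0r // leq_pmull.
Qed.

Lemma inv_nilp (A : comNzRingType) n (x : A) :
  x ^+ n = 0 -> exists y, y * (1 + x) = 1.
Proof.
move=> x0; exists (\sum_(i < n) (- x) ^+ i); apply: oppr_inj.
have := subrX1 (- x) n; rewrite exprNn x0 mulr0 sub0r => ->; ring.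
Qed.

(** The ring is not a domain; regularity is what allows the product denominators to be cancelled. *)
Lemma lreg_nilpD (A : comNzRingType) n (x : A) : x ^+ n = 0 -> GRing.lreg (1 + x).
Proof.
by case/inv_nilp=> y yx; apply: (can_inj (g := *%R y)) => z; rewrite mulrA yx mul1r.
Qed.

Lemma lreg_nilp (A : comNzRingType) n (x : A) : x ^+ n = 0 -> GRing.lreg (1 - x).
Proof.
by move=> x0; apply: (@lreg_nilpD _ n); rewrite exprNn x0 mulr0.
Qed.

Lemma lreg_prod_nat (A : comNzRingType) m n (F : nat -> A) :
    (forall j, (m <= j < n)%N -> GRing.lreg (F j)) ->
  GRing.lreg (\prod_(m <= j < n) F j).
Proof.
move=> regF; rewrite big_nat_cond; apply: (big_ind (@GRing.lreg A)).
- exact: lreg1.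
- exact: lregM.
by move=> j; rewrite andbT => /regF.
Qed.

Lemma nilpX (A : comNzRingType) (x : A) n m :
  x ^+ n = 0 -> (0 < m)%N -> (x ^+ m) ^+ n = 0.
Proof. by move=> x0 m_gt0; rewrite exprAC x0 expr0n; case: m m_gt0. Qed.

Lemma inv_theta (A : comNzRingType) n B (c x : A) :
  x ^+ n = 0 -> exists y, y * theta B c x = 1.
Proof.
move=> x0; rewrite thetaE; apply: (@inv_nilp _ n).
have -> : \sum_(1 <= s < B.+1) c ^+ s * x ^+ (s ^ 2) =
    x * \sum_(1 <= s < B.+1) c ^+ s * x ^+ (s ^ 2).-1.
  rewrite mulr_sumr; apply: eq_big_nat => s /andP[s_gt0 _].
  by rewrite mulrCA -exprS prednK // expn_gt0 s_gt0.
by rewrite -mulrnAr exprMn x0 mul0r.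
Qed.

Lemma prod_odd_even (A : comNzRingType) M (F : nat -> A) :
  \prod_(1 <= j < (2 * M).+1) F j =
  (\prod_(1 <= j < M.+1) F (2 * j - 1)%N) * \prod_(1 <= j < M.+1) F (2 * j)%N.
Proof.
have S N (f : nat -> A) :
    \prod_(1 <= j < N.+2) f j = \prod_(1 <= j < N.+1) f j * f N.+1.
  by rewrite big_nat_recr.
elim: M => [|M IHM]; first by rewrite !big_geq // mulr1.
rewrite (_ : 2 * M.+1 = (2 * M).+2)%N; last by lia.
rewrite !S IHM.
rewrite (_ : 2 * M.+1 - 1 = (2 * M).+1)%N; last by lia.
rewrite (_ : 2 * M.+1 = (2 * M).+2)%N; last by lia.
by rewrite !mulrA; congr (_ * _); rewrite mulrAC.
Qed.

(** The even-exponent factors of Gauss's product for phi(x) form the product for phi(x^2), so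
    phi(x)/phi(x^2) is the product of (1 - x^m)/(1 + x^m) over odd m. *)
Lemma theta_sqr_odd_prod (A : comNzRingType) M (x : A) : x ^+ (2 * M).+1 = 0 ->
  theta (2 * M) (-1) x * \prod_(1 <= j < M.+1) (1 + x ^+ (2 * j - 1)) =
  theta (2 * M) (-1) (x ^+ 2) * \prod_(1 <= j < M.+1) (1 - x ^+ (2 * j - 1)).
Proof.
move=> x0; have x20 : (x ^+ 2) ^+ M.+1 = 0.
  by rewrite -exprM; apply: expr_nilp x0 _; lia.
rewrite (theta_stable _ x20); last by lia.
have regQ : GRing.lreg (\prod_(1 <= j < M.+1) (1 + (x ^+ 2) ^+ j)).
  apply: lreg_prod_nat => j /andP[j_gt0 _].
  exact/lreg_nilpD/(nilpX x20 j_gt0).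
have E2 (f : A -> A) : \prod_(1 <= j < M.+1) f (x ^+ (2 * j)) =
    \prod_(1 <= j < M.+1) f ((x ^+ 2) ^+ j).
  by apply: eq_bigr => j _; rewrite exprM.
have := gauss_nilp x0; rewrite !prod_odd_even (E2 (fun y => 1 + y)).
rewrite (E2 (fun y => 1 - y)).
rewrite -(gauss_nilp x20).
move: regQ; move: (\prod_(_ <= _ < _) _) (\prod_(_ <= _ < _) _).
by move=> b c regb; rewrite mulrA => e; apply: regb; rewrite mulrC e; ring.
Qed.

(** G is the inverse of phi(q)/phi(q^2) times the value of phi(x)/phi(x^2) at x = q^3, by the
    odd-product formula at q and at q^3. *)
Lemma theta_quotient (A : comNzRingType) M (q G : A) : q ^+ (2 * M).+1 = 0 ->
    G * ((\prod_(1 <= j < M.+1) (1 + (q ^+ 3) ^+ (2 * j - 1))) *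
         \prod_(1 <= j < M.+1) (1 - q ^+ (2 * j - 1))) =
      (\prod_(1 <= j < M.+1) (1 + q ^+ (2 * j - 1))) *
        \prod_(1 <= j < M.+1) (1 - (q ^+ 3) ^+ (2 * j - 1)) ->
  G * theta (2 * M) (-1) q * theta (2 * M) (-1) (q ^+ 6) =
    theta (2 * M) (-1) (q ^+ 2) * theta (2 * M) (-1) (q ^+ 3).
Proof.
move=> q0; have q30 : (q ^+ 3) ^+ (2 * M).+1 = 0 by rewrite exprAC q0 expr0n.
have := theta_sqr_odd_prod q0; have := theta_sqr_odd_prod q30.
rewrite -exprM; set E3 := \prod_(_ <= _ < _) _; set O3 := \prod_(_ <= _ < _) _.
set E1 := \prod_(_ <= _ < _) _; set O1 := \prod_(_ <= _ < _) _ => t3 t1 GE.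
have regE : GRing.lreg (E3 * O1).
  apply: lregM; apply: lreg_prod_nat => j /andP[j_gt0 _].
    by apply: (lreg_nilpD (nilpX q30 _)); lia.
  by apply: (lreg_nilp (nilpX q0 _)); lia.
apply: regE.
have -> : E3 * O1 * (G * theta (2 * M) (-1) q * theta (2 * M) (-1) (q ^+ 6)) =
  (G * (E3 * O1)) * theta (2 * M) (-1) q * theta (2 * M) (-1) (q ^+ 6) by ring.
rewrite GE.
have -> : E1 * O3 * theta (2 * M) (-1) q * theta (2 * M) (-1) (q ^+ 6) =
  (theta (2 * M) (-1) q * E1) * (theta (2 * M) (-1) (q ^+ 6) * O3) by ring.
by rewrite t1 -t3; ring.
Qed.

(** * Truncated power series and the theta quotient for [S3bar] *)

(* Power series modulo q^(K+1). *)
Notation tps K := {poly %/ ('X^(K.+1) : {poly int})}.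

Lemma size_mk_monic_tps K : size (mk_monic ('X^(K.+1) : {poly int})) = K.+2.
Proof. by rewrite mk_monic_Xn size_polyXn. Qed.

Lemma coef_in_qpolyXn K (p : {poly int}) i :
  (i <= K)%N -> (in_qpoly 'X^(K.+1) p)`_i = p`_i.
Proof.
move=> le_iK; rewrite /in_qpoly /= mk_monic_Xn /=.
rewrite [p in RHS](Pdiv.RingMonic.rdivp_eq (monicXn _ K.+1)).
by rewrite coefD coefMXn ltnS le_iK add0r.
Qed.

Lemma coef_tps_gt K (a : tps K) i : (K < i)%N -> a`_i = 0.
Proof. by move=> lt_Ki; apply: big_coef_npoly; rewrite size_mk_monic_tps. Qed.

Lemma tpsP K (a b : tps K) : (forall i, (i <= K)%N -> a`_i = b`_i) -> a = b.
Proof.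
move=> ab; apply/npolyP => i; have [/ab //|lt_Ki] := leqP i K.
by rewrite !coef_tps_gt.
Qed.

Lemma coef_tpsM K (a b : tps K) i : (i <= K)%N ->
  (a * b)`_i = \sum_(j < i.+1) a`_j * b`_(i - j).
Proof.
move=> le_iK; rewrite -coefM -(coef_in_qpolyXn (val a * val b) le_iK).
by rewrite poly_of_qpolyM.
Qed.

Definition tps_q K : tps K := in_qpoly _ 'X.

Lemma coef_tps_q K n i : (i <= K)%N -> (tps_q K ^+ n)`_i = (i == n)%:R.
Proof. by move=> le_iK; rewrite -rmorphXn coef_in_qpolyXn // coefXn. Qed.

Lemma tps_q_nilp K : tps_q K ^+ K.+1 = 0.
Proof.
by apply: tpsP => i le_iK; rewrite coef_tps_q // coef0 ltn_eqF.
Qed.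

Definition tps_of K (f : fps) : tps K := in_qpoly _ (\poly_(i < K.+1) f i).

Lemma coef_tps_of K f i : (i <= K)%N -> (tps_of K f)`_i = f i.
Proof. by move=> le_iK; rewrite coef_in_qpolyXn // coef_poly ltnS le_iK. Qed.

Lemma tps_ofM K f g : tps_of K (fps_mul f g) = tps_of K f * tps_of K g.
Proof.
apply: tpsP => i le_iK; rewrite coef_tpsM // coef_tps_of //.
apply: eq_bigr => j _; have le_ji : (j <= i)%N by rewrite -ltnS.
by rewrite !coef_tps_of // (leq_trans _ le_iK) // leq_subr.
Qed.

Lemma tps_of1 K : tps_of K fps_one = 1.
Proof.
apply: tpsP => i le_iK; rewrite coef_tps_of // -(expr0 (tps_q K)).
by rewrite coef_tps_q.
Qed.

Lemma tps_of_prod K F N :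
  tps_of K (fps_prod F N) = \prod_(1 <= j < N.+1) tps_of K (F j).
Proof.
elim: N => [|N IHN]; first by rewrite big_geq // tps_of1.
by rewrite tps_ofM IHN [RHS]big_nat_recr.
Qed.

Lemma tps_of_inv K f : f 0%N = 1 -> tps_of K (fps_inv f) * tps_of K f = 1.
Proof.
move=> f0; rewrite -tps_ofM -(tps_of1 K); apply: tpsP => i le_iK.
by rewrite !coef_tps_of // fps_mulVf.
Qed.

Lemma tps_of_binom1 K m : tps_of K (fps_binom 1 m) = 1 + tps_q K ^+ m.
Proof.
apply: tpsP => i le_iK; rewrite coef_tps_of // coefD -(expr0 (tps_q K)).
by rewrite !coef_tps_q // /fps_binom; case: eqP.
Qed.

Lemma tps_of_binomN1 K m : tps_of K (fps_binom (-1) m) = 1 - tps_q K ^+ m.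
Proof.
apply: tpsP => i le_iK; rewrite coef_tps_of // coefB -(expr0 (tps_q K)).
by rewrite !coef_tps_q // /fps_binom; case: (i =P m); rewrite ?subr0 ?addr0.
Qed.

Lemma tps_of_schur3_factor K j : (0 < j)%N ->
  tps_of K (schur3_factor j) * ((1 + (tps_q K ^+ 3) ^+ (2 * j - 1)) *
                                (1 - tps_q K ^+ (2 * j - 1))) =
    (1 + tps_q K ^+ (2 * j - 1)) * (1 - (tps_q K ^+ 3) ^+ (2 * j - 1)).
Proof.
move=> j_gt0; rewrite /schur3_factor /fps_div; set m := (2 * j - 1)%N.
have m_gt0 : (0 < m)%N by rewrite /m; lia.
have den1 : fps_one_mod 1 (fps_mul (fps_binom 1 (3 * m)) (fps_binom (-1) m)).
  by apply: fps_mul_one_mod; apply: fps_binom_one_mod; lia.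
rewrite -!exprM -!tps_of_binom1 -!tps_of_binomN1 -tps_ofM tps_ofM -mulrA.
by rewrite tps_of_inv ?mulr1 ?tps_ofM // den1.
Qed.

(** The bound 2K appears because K factors of the product, with odd exponents up to 2K - 1, are
    kept. *)
Lemma S3bar_theta_quotient K (q := tps_q K) :
  tps_of K S3bar * theta (2 * K) (-1) q * theta (2 * K) (-1) (q ^+ 6) =
    theta (2 * K) (-1) (q ^+ 2) * theta (2 * K) (-1) (q ^+ 3).
Proof.
apply: theta_quotient; first by apply: expr_nilp (tps_q_nilp K) _; lia.
have -> : tps_of K S3bar = \prod_(1 <= j < K.+1) tps_of K (schur3_factor j).
  rewrite -tps_of_prod; apply: tpsP => i le_iK.
  by rewrite !coef_tps_of // (S3bar_prod le_iK).
rewrite -!big_split /=; apply: eq_big_nat => j /andP[j_gt0 _].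
exact: tps_of_schur3_factor.
Qed.

(** * Frobenius congruences and the generating function modulo 3 *)

Lemma sqr_sum_mod2 (A : comNzRingType) (I : Type) (r : seq I) (F : I -> A) :
  exists c, (\sum_(i <- r) F i) ^+ 2 = \sum_(i <- r) F i ^+ 2 + c *+ 2.
Proof.
elim: r => [|i r [c IHr]].
  by exists 0; rewrite !big_nil expr0n mul0rn addr0.
rewrite !big_cons sqrrD IHr; set s := \sum_(_ <- _) F _.
by exists (c + F i * s); ring.
Qed.

Lemma cube_sum_mod3 (A : comNzRingType) (I : Type) (r : seq I) (F : I -> A) :
  exists c, (\sum_(i <- r) F i) ^+ 3 = \sum_(i <- r) F i ^+ 3 + c *+ 3.
Proof.
elim: r => [|i r [c IHr]].
  by exists 0; rewrite !big_nil expr0n mul0rn addr0.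
rewrite !big_cons; move: IHr; set s := \sum_(_ <- _) F _; set t := \sum_(_ <- _) _.
move=> IHr; exists (c + F i ^+ 2 * s + F i * s ^+ 2).
have -> : (F i + s) ^+ 3 = F i ^+ 3 + s ^+ 3 + (F i ^+ 2 * s + F i * s ^+ 2) *+ 3.
  by ring.
by rewrite IHr; ring.
Qed.

Lemma theta_cube (A : comNzRingType) B (x : A) :
  exists c, theta B (-1) x ^+ 3 = theta B (-1) (x ^+ 3) + c *+ 3.
Proof.
have [c ->] := cube_sum_mod3 (box B) (fun i => (-1) ^+ `|i|%N * x ^+ (`|i| ^ 2)%N).
exists c; congr (_ + _); apply: eq_bigr => i _.
rewrite exprMn exprAC (exprAC _ _ 3); congr (_ ^+ _ * _).
by rewrite -signr_odd /= expr1.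
Qed.

Lemma S3bar_mod3 K (B := (2 * K)%N) (q := tps_q K) : exists c,
  tps_of K S3bar * (theta B (-1) (q ^+ 6) * theta B 1 (q ^+ 6)) =
    theta B (-1) q * theta B (-1) q * (theta B (-1) (q ^+ 2) * theta B 1 (q ^+ 6))
    + c *+ 3.
Proof.
have [c t3] := theta_cube B q.
have e : tps_of K S3bar * theta B (-1) q * theta B (-1) (q ^+ 6) =
  theta B (-1) (q ^+ 2) * theta B (-1) (q ^+ 3) := S3bar_theta_quotient K.
have [y y1] := inv_theta B (-1) (tps_q_nilp K).
rewrite -/q in y1.
(* Here [y] is the inverse of phi(q): dividing by phi(q) multiplies the error 3c from phi(q^3) =
   phi(q)^3 - 3c by [y] and the other factors. *)
exists (- (y * theta B 1 (q ^+ 6) * theta B (-1) (q ^+ 2) * c)).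
have e3 : theta B (-1) (q ^+ 3) = theta B (-1) q ^+ 3 - c *+ 3 by rewrite t3 addrK.
rewrite e3 in e; move: e y1.
move: (tps_of K S3bar) (theta B (-1) q) (theta B (-1) (q ^+ 2)) => G a b.
move: (theta B (-1) (q ^+ 6)) (theta B 1 (q ^+ 6)) => d d' e y1.
have -> : G * (d * d') = y * (G * a * d) * d'.
  by rewrite -{1}[G]mulr1 -y1; ring.
rewrite e.
have -> : y * (b * (a ^+ 3 - c *+ 3)) * d' =
    (y * a) * (a * a * (b * d')) - (y * d' * b * c) *+ 3 by ring.
by rewrite y1 mul1r mulNrn.
Qed.

(** * Coefficients of products of theta series *)

Lemma coef_tps_sum K (I : Type) (r : seq I) (F : I -> tps K) i :
  (\sum_(j <- r) F j)`_i = \sum_(j <- r) (F j)`_i.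
Proof.
by elim: r => [|j r IHr]; rewrite ?big_nil ?coef0 // !big_cons coefD IHr.
Qed.

Lemma coef_tpsMn K (a : tps K) n i : (a *+ n)`_i = a`_i *+ n.
Proof. by elim: n => [|n IHn]; rewrite ?coef0 // !mulrS coefD IHn. Qed.

Lemma coef_tps_sign K n (a : tps K) i : ((-1) ^+ n * a)`_i = (-1) ^+ n * a`_i.
Proof.
elim: n => [|n IHn]; first by rewrite !mul1r.
by rewrite !(exprS (-1)) -!mulrA !mulN1r coefN IHn.
Qed.

Lemma coef_theta0 K B m c : (0 < m)%N -> (theta B c (tps_q K ^+ m))`_0 = 1.
Proof.
move=> m_gt0; rewrite thetaE coefD coef_tpsMn coef_tps_sum.
rewrite -(expr0 (tps_q K)) coef_tps_q // big_nat_cond big1 ?mul0rn ?addr0 //.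
move=> s /andP[/andP[s_gt0 _] _]; rewrite -exprM coef_tpsM // big_ord1 coef_tps_q //.
by rewrite ltn_eqF ?mulr0 // muln_gt0 m_gt0 expn_gt0 s_gt0.
Qed.

Lemma coef_theta_pair K B m i : (i <= K)%N ->
  (theta B (-1) (tps_q K ^+ m) * theta B 1 (tps_q K ^+ m))`_i =
  \sum_(x <- box B) \sum_(y <- box B)
     (-1) ^+ `|x|%N * (i == m * (`|x| ^ 2 + `|y| ^ 2))%N%:R.
Proof.
move=> le_iK; rewrite big_distrlr /= coef_tps_sum; apply: eq_bigr => x _.
rewrite coef_tps_sum; apply: eq_bigr => y _.
by rewrite expr1n mul1r -mulrA coef_tps_sign -!exprM -exprD coef_tps_q // mulnDr.
Qed.

(** If i = 6(x^2 + y^2) is not a multiple of 12, then x and y have opposite parity, so exchanging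
    them flips the sign (-1)^x and the sum equals its own opposite. *)
Lemma coef_theta_pair_eq0 K B i : (i <= K)%N -> ~~ (12 %| i)%N ->
  (theta B (-1) (tps_q K ^+ 6) * theta B 1 (tps_q K ^+ 6))`_i = 0.
Proof.
move=> le_iK i12; rewrite coef_theta_pair //; set S := (LHS).
suff S2 : S + S = 0 by lia.
rewrite {1}/S exchange_big /S -big_split /=; apply: big1 => x _.
rewrite -big_split /=; apply: big1 => y _.
rewrite [X in (i == 6 * X)%N]addnC -mulrDl.
case: eqP => [i_eq|_]; last by rewrite mulr0.
rewrite -(signr_odd _ `|x|%N) -(signr_odd _ `|y|%N) mulr1.
have: odd `|x|%N != odd `|y|%N by nia.
by do 2 case: odd.
Qed.

Lemma theta4E (A : comNzRingType) B (q : A) :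
  theta B (-1) q * theta B (-1) q * (theta B (-1) (q ^+ 2) * theta B 1 (q ^+ 6)) =
  \sum_(x <- box B) \sum_(y <- box B) \sum_(z <- box B) \sum_(w <- box B)
     (-1) ^+ (`|x| + `|y| + `|z|)%N *
     q ^+ (`|x| ^ 2 + `|y| ^ 2 + (2 * `|z| ^ 2 + 6 * `|w| ^ 2))%N.
Proof.
rewrite [theta B _ q * theta B _ q]big_distrlr /= mulr_suml.
apply: eq_bigr => x _; rewrite mulr_suml; apply: eq_bigr => y _.
rewrite [theta _ _ _ * theta _ _ _]big_distrlr /= mulr_sumr.
apply: eq_bigr => z _; rewrite mulr_sumr; apply: eq_bigr => w _.
by rewrite expr1n mul1r -!exprM !exprD; ring.
Qed.

Lemma coef_theta4 K B i : (i <= K)%N -> let q := tps_q K in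
  (theta B (-1) q * theta B (-1) q * (theta B (-1) (q ^+ 2) * theta B 1 (q ^+ 6)))`_i =
  \sum_(x <- box B) \sum_(y <- box B) \sum_(z <- box B) \sum_(w <- box B)
     (-1) ^+ (`|x| + `|y| + `|z|)%N *
     (i == `|x| ^ 2 + `|y| ^ 2 + (2 * `|z| ^ 2 + 6 * `|w| ^ 2))%N%:R.
Proof.
move=> le_iK q; rewrite theta4E coef_tps_sum; apply: eq_bigr => x _.
rewrite coef_tps_sum; apply: eq_bigr => y _.
rewrite coef_tps_sum; apply: eq_bigr => z _.
rewrite coef_tps_sum; apply: eq_bigr => w _.
by rewrite coef_tps_sign coef_tps_q.
Qed.

(** * Counting representations by binary quadratic forms *)

Lemma leq_count_inj (T T' : eqType) (s : seq T) (s' : seq T') (P : pred T)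
    (P' : pred T') (f : T -> T') :
    uniq s -> {in P &, injective f} ->
    (forall x, P x -> (f x \in s') && P' (f x)) ->
  (count P s <= count P' s')%N.
Proof.
move=> s_uniq f_inj fP; rewrite -!size_filter -(size_map f).
apply: uniq_leq_size.
  rewrite map_inj_in_uniq ?filter_uniq // => x y.
  by rewrite !mem_filter => /andP[Px _] /andP[Py _]; apply: f_inj.
move=> y /mapP[x]; rewrite !mem_filter => /andP[/fP/andP[fs' fP'] _] ->.
by rewrite fs' fP'.
Qed.

Definition box2 B := [seq (x, y) | x <- box B, y <- box B].

Lemma box2_uniq B : uniq (box2 B).
Proof. by apply: allpairs_uniq; rewrite ?box_uniq // => -[? ?] [? ?]. Qed.

Lemma mem_box2 B (x y : int) : ((x, y) \in box2 B) = (`|x| <= B)%N && (`|y| <= B)%N.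
Proof.
rewrite -!mem_box; apply/allpairsP/andP => [[[? ?] /= [? ? [-> ->]]] //|[xB yB]].
by exists (x, y).
Qed.

Lemma sum_box2 B (P : int -> int -> bool) :
  \sum_(x <- box B) \sum_(y <- box B) (P x y)%:R =
    (count (fun p => P p.1 p.2) (box2 B))%:R :> int.
Proof.
rewrite -sum1_count natr_sum [RHS]big_mkcond /= big_allpairs_dep /=.
by apply: eq_bigr => x _; apply: eq_bigr => y _; case: (P _ _).
Qed.

(** Crude, but enough to keep every solution of a positive form with value at most [B] inside the
    box, hence also its images under the substitutions below. *)
Lemma absz_le_sqr (x : int) (B : nat) : x ^+ 2 <= B%:Z -> (`|x| <= B)%N.
Proof. by nia. Qed.

Lemma sqr_even (x a : int) : x ^+ 2 = a *+ 2 -> exists m, x = m *+ 2.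
Proof.
move=> e; exists (x %/ 2)%Z; have := divz_eq x 2.
have : (x %% 2)%Z = 0 \/ (x %% 2)%Z = 1 by lia.
move: (x %/ 2)%Z (x %% 2)%Z => m r [->|->] ex; first by lia.
by rewrite ex in e; exfalso; nia.
Qed.

(** The map (u, v) -> (u + v, u - v) matches representations of k with those of 2k, and x + y is
    even whenever x^2 + y^2 is, so the signs are all 1. *)
Lemma sum_two_squares_double B (k : int) : k *+ 2 <= B%:Z ->
  \sum_(x <- box B) \sum_(y <- box B)
     (-1) ^+ (`|x| + `|y|)%N * (x ^+ 2 + y ^+ 2 == k *+ 2)%:R =
  \sum_(u <- box B) \sum_(v <- box B) (u ^+ 2 + v ^+ 2 == k)%:R :> int.
Proof.
move=> leB; have even_add (x y : int) : x ^+ 2 + y ^+ 2 = k *+ 2 ->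
    exists m, x = m *+ 2 - y.
  move=> e; have [|m em] := @sqr_even (x + y) (k + x * y).
    by rewrite mulrnDl -e; ring.
  by exists m; lia.
transitivity (\sum_(x <- box B) \sum_(y <- box B)
    (x ^+ 2 + y ^+ 2 == k *+ 2)%:R : int).
  apply: eq_bigr => x _; apply: eq_bigr => y _.
  case: eqP => [/even_add[m em]|_]; last by rewrite !mulr0.
  by rewrite -signr_odd (_ : odd _ = false) ?mulr1 //; lia.
rewrite !sum_box2; congr (_%:R); apply/eqP; rewrite eqn_leq.
apply/andP; split.
  apply: (@leq_count_inj _ _ _ _ _ _
    (fun p : int * int => (((p.1 + p.2) %/ 2)%Z, ((p.1 - p.2) %/ 2)%Z)));
    first exact: box2_uniq.
    move=> [x y] [x' y']; rewrite !unfold_in /= => /eqP/even_add[m em].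
    move=> /eqP/even_add[m' em'].
    by case=> e1 e2; congr (_, _); lia.
  move=> [x y] /= /eqP e; have [m em] := even_add _ _ e.
  have -> : ((x + y) %/ 2)%Z = m by lia.
  have -> : ((x - y) %/ 2)%Z = m - y by lia.
  have e2 : m ^+ 2 + (m - y) ^+ 2 = k by rewrite em in e; nia.
  by rewrite e2 eqxx andbT mem_box2 !absz_le_sqr //; nia.
apply: (@leq_count_inj _ _ _ _ _ _ (fun p : int * int => (p.1 + p.2, p.1 - p.2)));
  first exact: box2_uniq.
  by move=> [x y] [x' y'] _ _ /= [e1 e2]; congr (_, _); lia.
move=> [x y] /= /eqP e.
have e2 : (x + y) ^+ 2 + (x - y) ^+ 2 = k *+ 2 by rewrite -e; ring.
by rewrite e2 eqxx andbT mem_box2 !absz_le_sqr //; nia.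
Qed.

(** The indicator of 3 | x makes the residue of the square a linear expression, usable by [lia]. *)
Lemma sqr_mod3 (x : int) : exists a, x ^+ 2 = 3 * a + 1 - (3 %| x)%Z%:R.
Proof.
exists ((x ^+ 2 - 1 + (3 %| x)%Z%:R) %/ 3)%Z.
by case: (boolP (3 %| x)%Z) => /= x3; nia.
Qed.

Lemma sqrz_abs (x : int) : (`|x| ^ 2)%N = x ^+ 2 :> int.
Proof. by rewrite -abszX gez0_abs // sqr_ge0. Qed.

Lemma exchange_big4 (V : nmodType) (I : Type) (r : seq I) (F : I -> I -> I -> I -> V) :
  \sum_(x <- r) \sum_(y <- r) \sum_(z <- r) \sum_(w <- r) F x y z w =
  \sum_(z <- r) \sum_(w <- r) \sum_(x <- r) \sum_(y <- r) F x y z w.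
Proof.
transitivity (\sum_(x <- r) \sum_(z <- r) \sum_(w <- r) \sum_(y <- r) F x y z w).
  apply: eq_bigr => x _; rewrite exchange_big; apply: eq_bigr => z _.
  exact: exchange_big.
by rewrite exchange_big; apply: eq_bigr => z _; apply: exchange_big.
Qed.

(* The rotation (v, w) -> ((-v - 3w)/2, (v - w)/2) of order 3 preserves v^2 + 3w^2
   and shifts the residue of v w modulo 3 by -v^2 = -1. *)
Lemma dvd3_count_norm3 B (k : int) : k <= B%:Z -> (2 %| k)%Z -> ~~ (3 %| k)%Z ->
  (3 %| count (fun p : int * int => p.1 ^+ 2 + 3 * p.2 ^+ 2 == k)%R (box2 B))%N.
Proof.
move=> leB k2 k3; set P := (fun p : int * int => _).
pose Q (r : int) p := P p && (((p.1 * p.2) %% 3)%Z == r).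
have step (r r' : int) : 0 <= r < 3 -> 0 <= r' < 3 -> ((r - 1 - r') %% 3)%Z = 0 ->
    (count (Q r) (box2 B) <= count (Q r') (box2 B))%N.
  move=> r3 r'3 rr'.
  have par (v w : int) : v ^+ 2 + 3 * w ^+ 2 = k -> exists m, v = w + m *+ 2.
    move=> e; have [l el] : exists l, k = l *+ 2 by exists (k %/ 2)%Z; lia.
    have [|m em] := @sqr_even (v - w) (l - w ^+ 2 - v * w).
      by rewrite 2!mulrnBl -el -e; ring.
    by exists m; lia.
  apply: (@leq_count_inj _ _ _ _ _ _ (fun p : int * int =>
    (((- p.1 - 3 * p.2) %/ 2)%Z, ((p.1 - p.2) %/ 2)%Z)));
    first exact: box2_uniq.
    move=> [v w] [v' w']; rewrite !unfold_in /= => /andP[/eqP/par[m /= em] _].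
    move=> /andP[/eqP/par[m' /= em'] _] [e1 e2].
    by congr (_, _); lia.
  move=> [v w] /= /andP[/eqP /= e /eqP /= er]; have [m em] := par _ _ e.
  have -> : ((- v - 3 * w) %/ 2)%Z = - (w *+ 2 + m) by lia.
  have -> : ((v - w) %/ 2)%Z = m by lia.
  have e2 : (- (w *+ 2 + m)) ^+ 2 + 3 * m ^+ 2 = k by rewrite -e em; ring.
  have := sqr_ge0 m; have := sqr_ge0 (- (w *+ 2 + m)) => s1 s2.
  rewrite mem_box2 !absz_le_sqr /=; [|lia|lia].
  rewrite /Q /P /= e2 eqxx /=; apply/eqP.
  have [a ea] := sqr_mod3 v.
  have v3 : (3 %| v)%Z = false.
    by apply: contraNF k3 => v3; rewrite -e expr2 rpredD ?dvdz_mulr.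
  have pq : v * w - - (w *+ 2 + m) * m = v ^+ 2 - 3 * m ^+ 2 by rewrite em; ring.
  rewrite v3 in ea; lia.
have Q_split p : P p = (Q 0%R p + Q 1%R p + Q 2%R p)%N :> nat.
  rewrite /Q; case: (P p) => //=.
  have : (0 <= (p.1 * p.2) %% 3 < 3)%Z by lia.
  move: ((p.1 * p.2) %% 3)%Z => r r3.
  have [->|[->|->]] : r = 0 \/ r = 1 \/ r = 2 by lia.
  - by [].
  - by [].
  - by [].
have -> : count P (box2 B) =
    (count (Q 0%R) (box2 B) + count (Q 1%R) (box2 B) + count (Q 2%R) (box2 B))%N.
  by elim: (box2 B) => //= p s ->; rewrite Q_split; lia.
(* The inequalities along the cycle 0, 2, 1, 0 force the three classes to have equal size. *)
have := step 0 2%R isT isT erefl; have := step 2%R 1 isT isT erefl.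
have := step 1 0 isT isT erefl.
lia.
Qed.

(** * Divisibility by 3 *)

(** Halving x^2 + y^2 turns the sum into one over u^2 + v^2 + z^2 + 3w^2 = n = i/2 with the sign of
    z only. As n = 2 mod 3, exactly one of u, v, z is divisible by 3; by symmetry it may be called
    z, the sign then sitting on z ([S0]) or on one of the other two ([S1], twice). So H = S0 + 2 S1,
    congruent to S0 - S1, in which only u and z of opposite parity survive; the remaining count over
    (v, w) is a multiple of 3 by [dvd3_count_norm3]. *)
Lemma theta4_dvd3 i B : (i <= B)%N -> (i %% 12 = 10)%N ->
  (3 %| \sum_(x <- box B) \sum_(y <- box B) \sum_(z <- box B) \sum_(w <- box B)
     (-1) ^+ (`|x| + `|y| + `|z|)%N *
     (i == `|x| ^ 2 + `|y| ^ 2 + (2 * `|z| ^ 2 + 6 * `|w| ^ 2))%N%:R)%Z.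
Proof.
move=> le_iB i10; pose n : int := (i %/ 2)%N.
pose E u v z : int := \sum_(w <- box B) (u ^+ 2 + v ^+ 2 + z ^+ 2 + 3 * w ^+ 2 == n)%:R.
pose sg (z : int) : int := (-1) ^+ `|z|%N.
pose d3 (z : int) : int := (3 %| z)%Z%:R.
have EC12 u v z : E u v z = E v u z.
  by apply: eq_bigr => w _; congr (_%:R); congr (nat_of_bool (_ == _)); ring.
have EC23 u v z : E u v z = E u z v.
  by apply: eq_bigr => w _; congr (_%:R); congr (nat_of_bool (_ == _)); ring.
have Ed3 u v z : E u v z = (d3 u + d3 v + d3 z) * E u v z.
  rewrite /E mulr_sumr; apply: eq_bigr => w _.
  case: eqP => [e|_]; last by rewrite mulr0.
  have [a ea] := sqr_mod3 u; have [b eb] := sqr_mod3 v; have [c ec] := sqr_mod3 z.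
  (* The sum of three indicators lies between 0 and 3, and the equation makes it 1 modulo 3. *)
  suff -> : d3 u + d3 v + d3 z = 1 by rewrite mul1r.
  have : ((d3 u + d3 v + d3 z - 1) %% 3)%Z = 0 by rewrite /d3 /n in e *; lia.
  by rewrite /d3; do 3 case: (3 %| _)%Z.
pose S (f : int -> int -> int -> int) : int :=
  \sum_(u <- box B) \sum_(v <- box B) \sum_(z <- box B) f u v z.
set H := \sum_(x <- _) _.
have SC12 f : S f = S (fun u v z => f v u z) by rewrite /S exchange_big.
have SC23 f : S f = S (fun u v z => f u z v).
  by apply: eq_bigr => u _; rewrite exchange_big.
have HE : H = S (fun u v z => sg z * E u v z).
  transitivity (\sum_(z <- box B) \sum_(w <- box B) sg z *
     \sum_(u <- box B) \sum_(v <- box B)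
       (u ^+ 2 + v ^+ 2 == n - z ^+ 2 - 3 * w ^+ 2)%:R).
    rewrite /H exchange_big4; apply: eq_bigr => z _; apply: eq_bigr => w _.
    rewrite -(@sum_two_squares_double B); last first.
      by have := sqr_ge0 z; have := sqr_ge0 w; rewrite /n; lia.
    rewrite mulr_sumr; apply: eq_bigr => x _; rewrite mulr_sumr; apply: eq_bigr => y _.
    rewrite mulrA -exprD addnC; congr (_ * (nat_of_bool _)%:R).
    rewrite -!sqrz_abs /n.
    move: (`|x| ^ 2)%N (`|y| ^ 2)%N (`|z| ^ 2)%N (`|w| ^ 2)%N => a b c d.
    by apply/eqP/eqP; lia.
  transitivity (\sum_(z <- box B) \sum_(w <- box B) \sum_(u <- box B)
     \sum_(v <- box B)
       sg z * (u ^+ 2 + v ^+ 2 + z ^+ 2 + 3 * w ^+ 2 == n)%:R); last first.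
    rewrite -exchange_big4; apply: eq_bigr => u _; apply: eq_bigr => v _.
    by apply: eq_bigr => z _; rewrite mulr_sumr.
  apply: eq_bigr => z _; apply: eq_bigr => w _.
  rewrite mulr_sumr; apply: eq_bigr => u _; rewrite mulr_sumr; apply: eq_bigr => v _.
  by congr (_ * (nat_of_bool _)%:R); apply/eqP/eqP; lia.
pose S0 := S (fun u v z => sg z * (d3 z * E u v z)).
pose S1 := S (fun u v z => sg u * (d3 z * E u v z)).
have eqS f g : (forall u v z, f u v z = g u v z) -> S f = S g.
  by move=> fg; do 3 apply: eq_bigr => ? _.
have HS : H = S0 + S1 *+ 2.
  have -> : H = S (fun u v z => sg z * (d3 u * E u v z))
       + S (fun u v z => sg z * (d3 v * E u v z)) + S0.
    rewrite HE /S0 /S -!big_split; apply: eq_bigr => u _; rewrite -!big_split.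
    apply: eq_bigr => v _; rewrite -!big_split; apply: eq_bigr => z _ /=.
    by rewrite {1}Ed3; ring.
  rewrite addrC; congr (_ + _); rewrite mulr2n; congr (_ + _).
    rewrite SC12 SC23 SC12; apply: eqS => u v z.
    by rewrite [E z v u]EC12 EC23 EC12.
  by rewrite SC23 SC12; apply: eqS => u v z; rewrite EC23 EC12.
pose D u z : int := \sum_(v <- box B) E u v z.
have S01 : S0 - S1 =
    \sum_(u <- box B) \sum_(z <- box B) (sg z - sg u) * d3 z * D u z.
  rewrite /S0 /S1 /S -sumrB; apply: eq_bigr => u _; rewrite -sumrB.
  rewrite [RHS](eq_bigr (fun z => \sum_(v <- box B) (sg z - sg u) * d3 z * E u v z)).
    rewrite [RHS]exchange_big; apply: eq_bigr => v _; rewrite -sumrB.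
    by apply: eq_bigr => z _; ring.
  by move=> z _; rewrite mulr_sumr.
have -> : H = S1 * 3 + (S0 - S1) by rewrite HS; ring.
rewrite S01; apply: rpredD; first exact: dvdz_mull.
apply: rpred_sum => u _; apply: rpred_sum => z _.
have [z3|z3] := boolP (3 %| z)%Z; last by rewrite /d3 (negbTE z3) mulr0 mul0r dvdz0.
have [uz|uz] := eqVneq (odd `|z|%N) (odd `|u|%N).
  by rewrite /sg -(signr_odd _ `|z|%N) uz signr_odd subrr !mul0r dvdz0.
apply: dvdz_mull.
have -> : D u z = \sum_(v <- box B) \sum_(w <- box B)
    (v ^+ 2 + 3 * w ^+ 2 == n - u ^+ 2 - z ^+ 2)%:R.
  apply: eq_bigr => v _; apply: eq_bigr => w _; congr (_%:R).
  move: (u ^+ 2) (v ^+ 2) (z ^+ 2) (w ^+ 2) => a b c d.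
  by congr nat_of_bool; apply/eqP/eqP; lia.
rewrite sum_box2.
have [a ea] := sqr_mod3 u; have [b eb] := sqr_mod3 z; rewrite z3 in eb.
have n6 : (n %% 6)%Z = 5 by rewrite /n; lia.
have := @dvd3_count_norm3 B (n - u ^+ 2 - z ^+ 2).
set N := count _ _; rewrite natz => N3; suff N3' : (3 %| N)%N.
  by rewrite !natz dvdzE.
have sz := sqr_ge0 z; have su := sqr_ge0 u.
(* Here n is odd and u^2 + z^2 is odd, so n - u^2 - z^2 is even; modulo 3 it is 2 - u^2, hence
   nonzero. *)
apply: N3; first by rewrite /n; lia.
  have uo : exists m, u ^+ 2 + z ^+ 2 = m *+ 2 + 1.
    have : exists m, u + z = m *+ 2 + 1 by exists ((u + z) %/ 2)%Z; lia.
    case=> m em; exists (m ^+ 2 *+ 2 + m *+ 2 - u * z).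
    have -> : u ^+ 2 + z ^+ 2 = (u + z) ^+ 2 - u * z *+ 2 by ring.
    by rewrite em; ring.
  by case: uo => m em; lia.
by lia.
Qed.

(** The factor multiplying G is a series in q^12 with constant term 1, so the coefficient of the
    product at n = 10 mod 12 is [S3bar n] plus multiples of earlier values in the same class modulo
    12: strong induction applies. *)
Lemma S3bar_dvd3 N : (N %% 12 = 10)%N -> (3 %| S3bar N)%Z.
Proof.
move=> N10; have [c e] := S3bar_mod3 N.
suff: forall n, (n <= N)%N -> (n %% 12 = 10)%N -> (3 %| S3bar n)%Z by apply.
move=> n; elim/ltn_ind: n => n IHn le_nN n10.
have := congr1 (fun a : tps N => a`_n) e; lazy beta.
rewrite coefD coef_tpsMn.
rewrite coef_theta4 // coef_tpsM // big_ord_recr /= subnn coef_tpsM // big_ord1.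
rewrite !coef_theta0 // mul1r mulr1 coef_tps_of // => /(canRL (addKr _)) ->.
apply: rpredD; last first.
  have d3 : (3 %| c`_n *+ 3)%Z by rewrite -[_`_n *+ 3]mulr_natr dvdz_mull.
  by apply: rpredD; [apply: theta4_dvd3; lia | exact: d3].
rewrite rpredN; apply: rpred_sum => j _; have lt_jn := ltn_ord j.
rewrite coef_tps_of; last by lia.
have [n12|n12] := boolP (12 %| n - j)%N; last first.
  by rewrite coef_theta_pair_eq0 ?mulr0 ?dvdz0 //; lia.
by rewrite dvdz_mulr // IHn //; lia.
Qed.

(** * Divisibility by 8 *)

(** Since (1 + 2t)^4 = 1 modulo 8, dividing by phi amounts to multiplying by phi^3 = 1 + 6t + 4t^2
    modulo 8; the squares of [t1] and [t6] come from the last term. *)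
Lemma mod8_expansion (A : comNzRingType) (G t1 t2 t3 t6 : A) :
    G * (1 + t1 *+ 2) * (1 + t6 *+ 2) = (1 + t2 *+ 2) * (1 + t3 *+ 2) ->
  exists c, G = 1 + (t2 + t3) *+ 2 + (t1 + t6) *+ 6 +
    (t6 * t6 + t2 * t3 + t2 * t1 + t2 * t6 + t3 * t1 + t3 * t6 + t1 * t6 + t1 ^+ 2) *+ 4
    + c *+ 8.
Proof.
move=> e; pose u t : A := t + t ^+ 2 *+ 3 + t ^+ 3 *+ 4 + t ^+ 4 *+ 2.
pose b t : A := t ^+ 2 + t ^+ 3.
pose Y t : A := t *+ 3 + t ^+ 2 *+ 2.
have th4 t : (1 + t *+ 2) ^+ 4 = 1 + u t *+ 8 by rewrite /u; ring.
have th3 t : (1 + t *+ 2) ^+ 3 = 1 + Y t *+ 2 + b t *+ 8 by rewrite /b /Y; ring.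
have e3 : G * ((1 + t1 *+ 2) ^+ 4 * (1 + t6 *+ 2) ^+ 4) =
    (1 + t2 *+ 2) * (1 + t3 *+ 2) * ((1 + t1 *+ 2) ^+ 3 * (1 + t6 *+ 2) ^+ 3).
  by rewrite -e; ring.
rewrite !th4 !th3 in e3.
pose P : A := (1 + t2 *+ 2) * (1 + t3 *+ 2).
pose U := u t1 + u t6 + u t1 * u t6 *+ 8.
pose W := P * (b t1 * (1 + Y t6 *+ 2) + b t6 * (1 + Y t1 *+ 2) + b t1 * b t6 *+ 8).
have {e3} GE : G = P * ((1 + Y t1 *+ 2) * (1 + Y t6 *+ 2)) + (W - G * U) *+ 8.
  have GU : G = G * ((1 + u t1 *+ 8) * (1 + u t6 *+ 8)) - G * U *+ 8.
    by rewrite /U; ring.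
  by rewrite {1}GU e3 /W /P; ring.
pose Z := t1 * t6 *+ 4 + t1 * t6 ^+ 2 *+ 3 + t1 ^+ 2 * t6 *+ 3
  + t1 ^+ 2 * t6 ^+ 2 *+ 2 + (t2 + t3 + t2 * t3 *+ 2) * Y t1 * Y t6
  + (t2 + t3) * (t1 + t6 + t1 ^+ 2 + t6 ^+ 2)
  + t2 * t3 * (Y t1 + Y t6).
exists (Z + (W - G * U)).
by rewrite {1}GE; move: (W - G * U) => V; rewrite /Z /P /Y; ring.
Qed.

Lemma sqr_mod48 x : (x ^ 2 %% 48)%N \in [:: 0; 1; 4; 9; 16; 25; 33; 36]%N.
Proof.
rewrite -modnXm; have := ltn_pmod x (isT : (0 < 48)%N).
by move: (x %% 48)%N; do 48 case=> //.
Qed.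

Lemma form_mod48 a b r x y :
    let sq := [:: 0; 1; 4; 9; 16; 25; 33; 36]%N in
    allrel (fun u v => (a * u + b * v) %% 48 != r)%N sq sq ->
  ((a * x ^ 2 + b * y ^ 2) %% 48 != r)%N.
Proof.
move=> sq /allrelP/(_ _ _ (sqr_mod48 x) (sqr_mod48 y)).
by rewrite -modnDm !modnMmr modnDm.
Qed.

Definition half_theta (A : pzRingType) (B : nat) (x : A) : A :=
  \sum_(1 <= s < B.+1) (-1) ^+ s * x ^+ (s ^ 2).

Lemma theta_half (A : pzRingType) B (x : A) :
  theta B (-1) x = 1 + half_theta B x *+ 2.
Proof. exact: thetaE. Qed.

Lemma coef_half_theta_eq0 K B a i : (i <= K)%N ->
  (forall s, i <> a * s ^ 2)%N -> (half_theta B (tps_q K ^+ a))`_i = 0.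
Proof.
move=> le_iK ai; rewrite coef_tps_sum big1 // => s _.
by rewrite coef_tps_sign -exprM coef_tps_q //; case: eqP => [/ai //|]; rewrite mulr0.
Qed.

Lemma coef_half_thetaM_eq0 K B a b i : (i <= K)%N ->
    (forall s r, i <> a * s ^ 2 + b * r ^ 2)%N ->
  (half_theta B (tps_q K ^+ a) * half_theta B (tps_q K ^+ b))`_i = 0.
Proof.
move=> le_iK abi; rewrite big_distrlr /= coef_tps_sum big1 // => s _.
rewrite coef_tps_sum big1 // => r _.
rewrite -mulrA coef_tps_sign mulrCA coef_tps_sign -!exprM -exprD coef_tps_q //.
by case: eqP => [/abi //|]; rewrite !mulr0.
Qed.

(** N may well be a sum of two squares (10 = 1 + 9), so no congruence kills the coefficient of t1^2;
    as it enters with factor 4, only its parity matters, and modulo 2 the diagonal terms alone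
    remain. *)
Lemma half_theta_sqr (A : comNzRingType) B (x : A) : exists c,
  half_theta B x ^+ 2 = \sum_(1 <= s < B.+1) x ^+ (2 * s ^ 2) + c *+ 2.
Proof.
have [c ->] := sqr_sum_mod2 (index_iota 1 B.+1) (fun s => (-1) ^+ s * x ^+ (s ^ 2)).
exists c; congr (_ + _); apply: eq_bigr => s _.
by rewrite exprMn sqrr_sign mul1r -exprM mulnC.
Qed.

Lemma S3bar_dvd8 N : (N %% 48 = 10)%N -> (forall x y, N <> x ^ 2 + 6 * y ^ 2)%N ->
  (8 %| S3bar N)%Z.
Proof.
move=> N48 N16; pose B := (2 * N)%N; pose q := tps_q N.
pose t a := half_theta B (q ^+ a).
have := S3bar_theta_quotient N; lazy zeta; rewrite !theta_half => /mod8_expansion[c GE].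
rewrite -[half_theta (2 * N) (tps_q N)]/(half_theta B q) -[q]expr1 in GE.
rewrite -!/(t _) in GE.
have [d t1E] := half_theta_sqr B (q ^+ 1).
have form a b : allrel (fun u v => (a * u + b * v) %% 48 != 10)%N
    [:: 0; 1; 4; 9; 16; 25; 33; 36]%N [:: 0; 1; 4; 9; 16; 25; 33; 36]%N ->
    (forall x y, N <> a * x ^ 2 + b * y ^ 2)%N.
  move=> /form_mod48 ab x y e; have := ab x y; by rewrite -e N48.
have t_eq0 a : (forall s, N <> a * s ^ 2)%N -> (t a)`_N = 0.
  exact: coef_half_theta_eq0.
have tt_eq0 a b : (forall s r, N <> a * s ^ 2 + b * r ^ 2)%N -> (t a * t b)`_N = 0.
  exact: coef_half_thetaM_eq0.
have single a : (forall x y, N <> a * x ^ 2 + 6 * y ^ 2)%N ->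
    (forall s, N <> a * s ^ 2)%N.
  by move=> a6 s e; apply: (a6 s 0%N); rewrite muln0 addn0.
have N16' x y : (N <> 1 * x ^ 2 + 6 * y ^ 2)%N by rewrite mul1n; apply: N16.
have coefD_eq0 (a b : tps N) : a`_N = 0 -> b`_N = 0 -> (a + b)`_N = 0.
  by move=> a0 b0; rewrite coefD a0 b0.
have oneN : (1 : tps N)`_N = 0.
  by rewrite -(expr0 (tps_q N)) coef_tps_q //; case: eqP => // N0; rewrite N0 in N48.
have sq_eq0 : (\sum_(1 <= s < B.+1) (q ^+ 1) ^+ (2 * s ^ 2))`_N = 0.
  rewrite coef_tps_sum big1 // => s _; rewrite -!exprM coef_tps_q // mul1n.
  by case: eqP => // /(@single 2 (form 2%N 6%N isT)).
rewrite -(coef_tps_of S3bar (leqnn N)); move: t1E; rewrite -/(t 1) => t1E.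
have lin (G a b e k : tps N) : G = 1 + a *+ 2 + b *+ 6 + e *+ 4 + c *+ 8 ->
    e = k + d *+ 2 -> a`_N = 0 -> b`_N = 0 -> k`_N = 0 -> (8 %| G`_N)%Z.
  move=> -> -> a0 b0 k0; rewrite !(coefD, coef_tpsMn) oneN a0 b0 k0.
  by move: (c`_N) (d`_N) => c' d'; lia.
(* The bracket of [mod8_expansion] with t1^2 replaced by its diagonal part. Each other product gives
   a form excluded modulo 48, save [t 1 * t 6], excluded by hypothesis. *)
pose k := t 6 * t 6 + t 2 * t 3 + t 2 * t 1 + t 2 * t 6 + t 3 * t 1 + t 3 * t 6
  + t 1 * t 6 + \sum_(1 <= s < B.+1) (q ^+ 1) ^+ (2 * s ^ 2).
apply: (lin _ _ _ _ k GE).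
- by rewrite t1E addrA.
- by apply: coefD_eq0; apply: t_eq0; apply: single; apply: form.
- by apply: coefD_eq0; apply: t_eq0; apply: single => //; apply: form.
apply: (coefD_eq0 _ _ _ sq_eq0).
apply: (coefD_eq0 _ _ _ (tt_eq0 1%N 6%N N16')).
apply: (coefD_eq0 _ _ _ (tt_eq0 _ _ (form 3%N 6%N isT))).
apply: (coefD_eq0 _ _ _ (tt_eq0 _ _ (form 3%N 1%N isT))).
apply: (coefD_eq0 _ _ _ (tt_eq0 _ _ (form 2%N 6%N isT))).
apply: (coefD_eq0 _ _ _ (tt_eq0 _ _ (form 2%N 1%N isT))).
apply: (coefD_eq0 _ _ _ (tt_eq0 _ _ (form 2%N 3%N isT))).
exact: (tt_eq0 _ _ (form 6%N 6%N isT)).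
Qed.

(** * The argument N and the form x^2 + 6 y^2 *)

Lemma nonresidue_dvd (p x y : nat) : prime p -> legendre (- 6) p = - 1 ->
  (p %| x ^ 2 + 6 * y ^ 2)%N -> (p %| x)%N && (p %| y)%N.
Proof.
move=> p_prime; rewrite /legendre; case: ifP => // p6.
case: existsP => // nores _ pN.
have p_gt0 := prime_gt0 p_prime.
have py : (p %| y)%N.
  apply/idPn => npy; case: nores.
  (* Bezout gives p | 1 + a y, so a = -1/y modulo p and (a x)^2 = -6 modulo p, contradicting
     nonresiduosity. *)
  have [a _] := Bezoutl y p_gt0.
  have /eqP -> : coprime p y by rewrite prime_coprime.
  move=> /dvdnP[d ed]; case/dvdnP: pN => c ec.
  exists (Ordinal (ltn_pmod (a * x) p_gt0)) => /=; rewrite eqz_mod_dvd.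
  have er := divn_eq (a * x) p; set r := (_ %% _)%N in er *.
  set l := (_ %/ _)%N in er.
  have -> : r%:Z ^+ 2 - - 6 = p%:Z * (a%:Z ^+ 2 * c%:Z - 2 * a%:Z * x%:Z * l%:Z
      + l%:Z ^+ 2 * p%:Z - 6 * d%:Z * (1 + a%:Z * y%:Z) + 12 * d%:Z).
    have ed' : 1 + a%:Z * y = d%:Z * p by lia.
    have ec' : x%:Z ^+ 2 + 6 * y%:Z ^+ 2 = c%:Z * p by lia.
    have -> : r%:Z = a%:Z * x - l%:Z * p by lia.
    rewrite [RHS](_ : _ = a%:Z ^+ 2 * (c%:Z * p) - 6 * (d%:Z * p) * (1 + a%:Z * y) +
      12 * (d%:Z * p) + p%:Z * (l%:Z ^+ 2 * p%:Z - 2 * a%:Z * x%:Z * l%:Z)); last by ring.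
    by rewrite -ed' -ec'; ring.
  exact: dvdz_mulr.
rewrite py andbT; move: pN; rewrite dvdn_addl ?Euclid_dvdX //.
  by case/andP.
by rewrite dvdn_mull // dvdn_exp.
Qed.

(** Descent: p divides both x and y, so p^2 can be divided out; at exponent 1 this would leave p
    dividing [M]. *)
Lemma odd_valuation_not_norm (p a M x y : nat) : prime p -> legendre (- 6) p = - 1 ->
  ~~ (p %| M)%N -> (p ^ (2 * a + 1) * M <> x ^ 2 + 6 * y ^ 2)%N.
Proof.
move=> p_prime leg pM; have p_gt0 := prime_gt0 p_prime.
elim: a x y => [|a IHa] x y e.
  have : (p %| x ^ 2 + 6 * y ^ 2)%N by rewrite -e muln0 add0n expn1 dvdn_mulr.
  move/(nonresidue_dvd p_prime leg)/andP=> [/dvdnP[x' ex] /dvdnP[y' ey]].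
  case/negP: pM; apply/dvdnP; exists (x' ^ 2 + 6 * y' ^ 2)%N.
  by apply/eqP; rewrite -(eqn_pmul2l p_gt0); apply/eqP; move: e; rewrite ex ey; lia.
have : (p %| x ^ 2 + 6 * y ^ 2)%N by rewrite -e addn1 expnS -mulnA dvdn_mulr.
move/(nonresidue_dvd p_prime leg)/andP=> [/dvdnP[x' ex] /dvdnP[y' ey]].
apply: (IHa x' y'); apply/eqP.
rewrite -(@eqn_pmul2l (p ^ 2)) ?expn_gt0 ?p_gt0 //; apply/eqP.
have -> : (p ^ 2 * (x' ^ 2 + 6 * y' ^ 2))%N = (x ^ 2 + 6 * y ^ 2)%N.
  by rewrite ex ey; lia.
by rewrite -e mulnA -expnD; congr (_ ^ _ * _)%N; lia.
Qed.

Lemma sqr_mod24 p : (5 <= p)%N -> prime p -> (p ^ 2 %% 24 = 1)%N.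
Proof.
move=> p5 p_prime; have : (p %% 24 < 24)%N by rewrite ltn_pmod.
have p2 : ~~ (2 %| p)%N by rewrite dvdn_prime2 //; apply/eqP; lia.
have p3 : ~~ (3 %| p)%N by rewrite dvdn_prime2 //; apply/eqP; lia.
have : ~~ (2 %| p %% 24)%N by lia.
have : ~~ (3 %| p %% 24)%N by lia.
rewrite -modnXm; move: (p %% 24)%N; do 24 case=> //.
Qed.

Theorem theorem4p6 (p : nat) (p_ge5 : (5 <= p)%N) (p_prime : prime p)
    (p_leg : legendre (- 6) p = - 1) (alpha n i : nat)
    (i_ge1 : (1 <= i)%N) (i_le : (i <= p - 1)%N) :
  (S3bar (48 * p ^ (2 * alpha + 2) * n
            + 2 * (24 * i + 5 * p) * p ^ (2 * alpha + 1))%N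
     = 0 %[mod 24])%Z.
Proof.
set N := (48 * _ * _ + _)%N.
pose M := (48 * (p * n + i) + 10 * p)%N.
have NE : N = (p ^ (2 * alpha + 1) * M)%N.
  by rewrite /N /M (_ : 2 * alpha + 2 = (2 * alpha + 1).+1)%N ?expnS; lia.
have pM : ~~ (p %| M)%N.
  have pi : ~~ (p %| i)%N by rewrite gtnNdvd //; lia.
  have -> : M = (48 * i + (48 * n + 10) * p)%N by rewrite /M; lia.
  rewrite dvdn_addl; last exact: dvdn_mull.
  rewrite Euclid_dvdM // negb_or pi andbT.
  rewrite (_ : 48 = 2 ^ 4 * 3)%N // Euclid_dvdM // Euclid_dvdX // !dvdn_prime2 //.
  by lia.
(* N = 10 p^(2 alpha + 2) modulo 48, and p^2 = 1 modulo 24 suffices because 10 * 24 is a multiple of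
   48. *)
have N48 : (N %% 48 = 10)%N.
  have NE2 : N = (48 * (p ^ (2 * alpha + 1) * (p * n + i)) + 10 * (p ^ 2) ^ alpha.+1)%N.
    rewrite NE /M -expnM (_ : 2 * alpha.+1 = (2 * alpha + 1).+1)%N ?expnS; lia.
  have : ((p ^ 2) ^ alpha.+1 %% 24 = 1)%N by rewrite -modnXm sqr_mod24 // exp1n.
  rewrite NE2; lia.
have S8 : (8 %| S3bar N)%Z.
  by apply: S3bar_dvd8 => // x y; rewrite NE; apply: odd_valuation_not_norm.
have S3 : (3 %| S3bar N)%Z by apply: S3bar_dvd3; lia.
by lia.
Qed.
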